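(* Let $k \geq 2$ and $n > \frac{k(k-1)}{\sqrt{8k}-1}$ be integers. For any partial $k$-star decomposition $\mathcal{A}$ of $K_n$ there is a nonnegative integer $s$ such that $\mathcal{A}$ can be embedded in a $k$-star decomposition of $K_{n+s}$, where $s \leq 2k-2$ if $k$ is odd and $s \leq 3k-2$ if $k$ is even.
   Context: All graphs are finite and simple. A $k$-star is a complete bipartite graph $K_{1,k}$. A $k$-star decomposition of a graph $G$ is a set of $k$-stars that are subgraphs of $G$ such that each edge of $G$ is in exactly one of the $k$-stars. A partial $k$-star decomposition of $G$ is a set (possibly empty) of $k$-stars that are subgraphs of $G$ such that each edge of $G$ is in at most one of the $k$-stars. An embedding of a partial $k$-star decomposition $\mathcal{A}$ of a graph $G$ is a partial $k$-star decomposition $\mathcal{B}$ of a graph $H$ such that $\mathcal{A} \subseteq \mathcal{B}$ and $G$ is a subgraph of $H$; we then say $\mathcal{A}$ is embedded in $\mathcal{B}$. $K_m$ denotes the complete graph on $m$ vertices. *)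

(* Defs.v *)
From HB Require Import structures.
From mathcomp Require Import all_boot.

Set Implicit Arguments.
Unset Strict Implicit.
Unset Printing Implicit Defensive.

(* A finite simple graph whose vertices are drawn from the finite type T,
   given as the pair (vertex set, edge set); the vertex set need not be all
   of T, so that subgraphs are graphs of the same type. *)
Definition wf_graph (T : finType) (VE : {set T} * {set {set T}}) : bool :=
  [forall e in VE.2, (#|e| == 2) && (e \subset VE.1)].

Record graph (T : finType) := Graph {
  graph_val : {set T} * {set {set T}};
  graph_wf : wf_graph graph_val
}.

HB.instance Definition _ (T : finType) := [isSub for @graph_val T].
HB.instance Definition _ (T : finType) := [Finite of graph T by <:].

Definition gverts (T : finType) (G : graph T) : {set T} := (graph_val G).1.
Definition gedges (T : finType) (G : graph T) : {set {set T}} :=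
  (graph_val G).2.

Definition subgraph (T : finType) (G H : graph T) : bool :=
  (gverts G \subset gverts H) && (gedges G \subset gedges H).

Lemma complete_graph_wf (T : finType) :
  wf_graph ([set: T], [set e : {set T} | #|e| == 2]).
Proof. by apply/forall_inP => e; rewrite inE /= => ->; rewrite subsetT. Qed.

Definition complete_graph (T : finType) : graph T :=
  Graph (complete_graph_wf T).

Definition K (m : nat) : graph 'I_m := complete_graph 'I_m.

Lemma map_graph_wf (T U : finType) (f : T -> U) (f_inj : injective f)
    (G : graph T) :
  wf_graph (f @: gverts G, [set f @: (e : {set T}) | e in gedges G]).
Proof.
apply/forall_inP => _ /imsetP[e eG ->] /=.
have /forall_inP /(_ _ eG) /andP[e2 esub] := graph_wf G.
by rewrite card_imset // e2 imsetS.
Qed.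

Definition map_graph (T U : finType) (f : T -> U) (f_inj : injective f)
    (G : graph T) : graph U :=
  Graph (map_graph_wf f_inj G).

Definition is_complete_bipartite (p q : nat) (T : finType) (S : graph T) :
    Prop :=
  exists X Y : {set T},
    [/\ [disjoint X & Y], #|X| = p, #|Y| = q,
        gverts S = X :|: Y
      & gedges S = [set [set x; y] | x in X, y in Y]].

Definition is_star (k : nat) (T : finType) (S : graph T) : Prop :=
  is_complete_bipartite 1 k S.

Definition star_decomposition (k : nat) (T : finType) (G : graph T)
    (A : {set graph T}) : Prop :=
  (forall S, S \in A -> is_star k S /\ subgraph S G) /\
  (forall e, e \in gedges G -> #|[set S in A | e \in gedges S]| = 1).

Definition partial_star_decomposition (k : nat) (T : finType) (G : graph T)
    (A : {set graph T}) : Prop :=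
  (forall S, S \in A -> is_star k S /\ subgraph S G) /\
  (forall e, e \in gedges G -> #|[set S in A | e \in gedges S]| <= 1).

(* The inclusion of G in H is taken along an injection f of the ambient vertex
   types, because G and H need not share one. *)
Definition embedding (k : nat) (T U : finType) (f : T -> U)
    (f_inj : injective f) (G : graph T) (A : {set graph T})
    (H : graph U) (B : {set graph U}) : Prop :=
  [/\ partial_star_decomposition k G A,
      partial_star_decomposition k H B,
      [set map_graph f_inj S | S in A] \subset B
    & subgraph (map_graph f_inj G) H].

(* Main.v *)
Require Import Defs.
From mathcomp Require Import all_boot all_order all_algebra.
From mathcomp Require Import zify ring.
Import Order.TTheory GRing.Theory Num.Theory.
Set Implicit Arguments.
Unset Strict Implicit.
Unset Printing Implicit Defensive.

(** Add k-stars inside K_n to the given ones for as long as possible. The graph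
L of the edges then left over has maximum degree at most k - 1. It remains to
decompose L together with all edges that meet the s new vertices.

By Hall's theorem, a graph with edge set E has a k-star decomposition with c(v)
stars centred at each vertex v as soon as |E| = k * sum c and every vertex set
X spans at most k * (sum of c over X) edges: give each vertex v exactly k * c(v)
slots and match every edge with a slot at one of its ends
([star_decomposition_of_centres]). So everything reduces to a choice of c.

Take s in the allowed range with s >= k and k | C(n + s, 2)
([exists_admissible_order]); the number of stars to be found is then an
integer b.

If s >= 2k or b >= n + s, centre one star at each old vertex and distribute the
b - n others as evenly as possible over the new vertices
([balanced_centres_bound]).

Otherwise b < n + s, and the choice is c = 0 on an independent set Z of L with
n + s - b elements and c = 1 on all other vertices
([independent_centres_bound]). Such a Z exists by Turan's bound
n^2 <= alpha(L) * (n + 2 |L|). By the inequality of arithmetic and geometric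
means, 2k alpha(L) + n + 2 |L| >= sqrt(8k) n, and this exceeds k(k - 1) + n
exactly because of the lower bound assumed on n ([enough_independent]).

In both cases the condition on X depends on the part W of X among the old
vertices and on the number j of new vertices in X. For a fixed W the slack in it
is piecewise concave in j, so that it has to be checked for very few values of j
only ([quadratic_under_chord]). *)

(** * Hall's and Turan's theorems *)

(** Rado's argument: as long as some N x has two elements, one of them can be
removed without destroying Hall's condition, because the cardinality of a union
is submodular. Once every N x is a singleton, the condition says that these
singletons are distinct. The element y0 is only the value off D. *)
Lemma hall_marriage (X Y : finType) (y0 : Y) (D : {set X}) (N : X -> {set Y}) :
    (forall F : {set X}, F \subset D -> #|F| <= #|\bigcup_(x in F) N x|) ->
  exists f : X -> Y, {in D &, injective f} /\ {in D, forall x, f x \in N x}.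
Proof.
have [m] := ubnP (\sum_(x in D) #|N x|); elim: m N => // m IHm N le_m hall.
have [/exists_inP[x xD /card_gt1P[y1 [y2 [y1N y2N ne_y]]]] | small] :=
  boolP [exists x in D, 1 < #|N x|].
  pose del y x' := if x' == x then N x :\ y else N x'.
  have del_sub y x' : del y x' \subset N x'.
    by rewrite /del; case: eqP => [->|_]; rewrite ?subD1set.
  (* If both removals were to fail, they would fail on sets F1 and F2 that
     contain x, and then Hall's condition for F1 :|: F2 and for
     (F1 :&: F2) :\ x would be contradictory. *)
  have [y hall_y yN] : exists2 y, forall F : {set X}, F \subset D ->
      #|F| <= #|\bigcup_(x' in F) del y x'| & y \in N x.
    case: (boolP [forall F : {set X}, (F \subset D) ==>
        (#|F| <= #|\bigcup_(x' in F) del y1 x'|)]) => [/forallP h1|].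
      by exists y1 => // F FD; have /implyP := h1 F; apply.
    case: (boolP [forall F : {set X}, (F \subset D) ==>
        (#|F| <= #|\bigcup_(x' in F) del y2 x'|)]) => [/forallP h2 _|].
      by exists y2 => // F FD; have /implyP := h2 F; apply.
    case/forallPn => F2; rewrite negb_imply -ltnNge => /andP[F2D lt2].
    case/forallPn => F1; rewrite negb_imply -ltnNge => /andP[F1D lt1].
    have xF y (F : {set X}) : F \subset D ->
        #|\bigcup_(x' in F) del y x'| < #|F| -> x \in F.
      move=> FD; apply: contraTT => xF; rewrite -leqNgt.
      rewrite (eq_bigr N) => [|x' x'F]; first exact: hall.
      by rewrite /del; case: eqP => // eq_x; rewrite -eq_x x'F in xF.
    have xF1 := xF _ _ F1D lt1; have xF2 := xF _ _ F2D lt2.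
    set B1 := \bigcup_(x' in F1) _ in lt1; set B2 := \bigcup_(x' in F2) _ in lt2.
    have leU : #|F1 :|: F2| <= #|B1 :|: B2|.
      apply: leq_trans (hall _ _) (subset_leq_card _); first by rewrite subUset F1D.
      apply/bigcupsP => x' x'F; have [->|ne_x] := eqVneq x' x.
        apply/subsetP => z zN; rewrite inE; have [eq_z|ne_z] := eqVneq z y1.
          apply/orP; right; apply/bigcupP; exists x => //.
          by rewrite /del eqxx !inE zN eq_z ne_y.
        by apply/orP; left; apply/bigcupP; exists x; rewrite // /del eqxx !inE zN ne_z.
      move: x'F; rewrite inE => /orP[x'F|x'F]; apply/subsetP => z zN; rewrite inE.
        by apply/orP; left; apply/bigcupP; exists x'; rewrite // /del (negPf ne_x).
      by apply/orP; right; apply/bigcupP; exists x'; rewrite // /del (negPf ne_x).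
    have leI : #|(F1 :&: F2) :\ x| <= #|B1 :&: B2|.
      apply: leq_trans (hall _ _) (subset_leq_card _).
        apply: subset_trans (subD1set _ _) _.
        exact: subset_trans (subsetIl _ _) F1D.
      apply/bigcupsP => x'; rewrite !inE => /and3P[ne_x x'F1 x'F2].
      by apply/subsetP => z zN; rewrite inE; apply/andP; split; apply/bigcupP;
        exists x'; rewrite // /del (negPf ne_x).
    have xI : x \in F1 :&: F2 by rewrite inE xF1.
    have := cardsUI F1 F2; have := cardsUI B1 B2; have := cardsD1 x (F1 :&: F2).
    rewrite xI; lia.
  have [|f [f_inj fN]] := IHm (del y) _ hall_y.
    rewrite (bigD1 x) //= in le_m; rewrite (bigD1 x) //=.
    rewrite {1}/del eqxx (eq_bigr (fun x' => #|N x'|)); last first.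
      by move=> x' /andP[_ /negPf ne_x]; rewrite /del ne_x.
    have := cardsD1 y (N x); rewrite yN; lia.
  by exists f; split=> // x' x'D; apply: (subsetP (del_sub y x')); apply: fN.
have N1 x : x \in D -> #|N x| = 1.
  move=> xD; apply/eqP; rewrite eqn_leq; apply/andP; split.
    by rewrite leqNgt; apply: contra small => lt1; apply/exists_inP; exists x.
  by have := hall [set x]; rewrite sub1set cards1 big_set1; apply.
pose f x := odflt y0 [pick y in N x].
have fN : {in D, forall x, N x = [set f x]}.
  move=> x /N1/eqP/cards1P[y Ny]; rewrite /f; case: pickP => [z|/(_ y)].
    by rewrite Ny inE => /eqP ->.
  by rewrite Ny inE eqxx.
exists f; split=> [x1 x2 x1D x2D eq_f|x xD]; last by rewrite fN ?set11.
apply/eqP; apply/idPn => ne_x; have := hall [set x1; x2].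
rewrite subUset !sub1set x1D x2D cards2 ne_x bigcup_setU !big_set1 !fN //.
by rewrite eq_f setUid cards1; move/(_ isT).
Qed.

(** This is Turan's theorem for the graph whose closed neighbourhoods r
describes. Choose a vertex v of least degree and delete its closed
neighbourhood C: the sum on the right drops by at least |C|^2, since each
element of C contributes at least |C|, and the independent set found in the rest
can be enlarged by v. *)
Lemma independent_set_bound (T : finType) (r : rel T) (W : {set T}) :
    reflexive r -> symmetric r ->
  exists Z : {set T}, [/\ Z \subset W, {in Z &, forall u w, r u w -> u = w}
    & #|W| ^ 2 <= #|Z| * \sum_(u in W) #|[set w in W | r u w]|].
Proof.
move=> r_refl r_sym; have [m] := ubnP #|W|; elim: m W => // m IHm W le_m.
have [->|[v0 v0W]] := set_0Vmem W.
  by exists set0; rewrite cards0 sub0set; split=> // u w; rewrite inE.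
pose d (U : {set T}) u := #|[set w in U | r u w]|.
case: (arg_minnP (d W) v0W) => /= v vW min_v {v0 v0W}.
have {}vW : v \in W := vW.
pose C := [set w in W | r v w].
have vC : v \in C by rewrite inE vW r_refl.
have CW : C \subset W by apply/subsetP => w; rewrite inE => /andP[].
have cardW : #|W| = #|C| + #|W :\: C| by rewrite -(cardsID C W) (setIidPr CW).
have [|Z [ZW Zind leZ]] := IHm (W :\: C).
  by have : 0 < #|C| by [apply/card_gt0P; exists v]; lia.
exists (v |: Z); split.
- by rewrite subUset sub1set vW (subset_trans ZW) ?subsetDl.
- move=> u w /setU1P[->|uZ] /setU1P[->|wZ] // r_uw; last exact: Zind.
    by have := subsetP ZW w wZ; rewrite !inE r_uw andbC; case: (w \in W).
  by have := subsetP ZW u uZ; rewrite !inE r_sym r_uw andbC; case: (u \in W).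
have vZ : v \notin Z by apply: contraL vC => /(subsetP ZW); rewrite inE => /andP[].
rewrite cardsU1 vZ cardW.
set D := \sum_(u in W :\: C) _ in leZ; set c := #|C|; set n' := #|W :\: C| in leZ *.
have leD : c ^ 2 + D <= \sum_(u in W) #|[set w in W | r u w]|.
  rewrite (big_setID C) /= (setIidPr CW) leq_add //.
    rewrite -mulnn -sum_nat_const leq_sum // => u uC.
    exact: min_v (subsetP CW u uC).
  by apply: leq_sum => u _; apply/subset_leq_card/subsetP => w;
    rewrite !inE => /andP[/andP[_ ->]].
apply: leq_trans (leq_mul (leqnn _) leD).
(* The square of the left-hand side is at most 4 * (|Z| * c^2) * D. *)
have : 2 * (c * n') <= #|Z| * c ^ 2 + D.
  rewrite -leq_sqr; have := nat_AGM2 (#|Z| * c ^ 2) D.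
  by move=> [+ _]; apply: leq_trans; nia.
nia.
Qed.

(** * Stars with prescribed centres *)

Definition edges_within (T : finType) (E : {set {set T}}) (X : {set T}) :=
  [set e in E | e \subset X].

Definition neighbours (T : finType) (E : {set {set T}}) (v : T) :=
  [set w | [set v; w] \in E].

Lemma in_neighbours (T : finType) (E : {set {set T}}) (v w : T) :
  (w \in neighbours E v) = ([set v; w] \in E).
Proof. by rewrite inE. Qed.

Definition covered (T : finType) (A : {set graph T}) : {set {set T}} :=
  \bigcup_(S in A) gedges S.

Lemma set2_inj (T : finType) (v : T) : injective (fun w => [set v; w]).
Proof.
move=> w1 w2 /= eq_w; have : w1 \in [set v; w2] by rewrite -eq_w set22.
have : w2 \in [set v; w1] by rewrite eq_w set22.
by rewrite !inE => /orP[/eqP ->|/eqP //] /orP[/eqP|/eqP].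
Qed.

Lemma edge_through (T : finType) (v : T) (e : {set T}) :
  #|e| = 2 -> v \in e -> exists2 w, w != v & e = [set v; w].
Proof.
move=> /eqP/cards2P[x [y [ne_xy ->]]]; rewrite !inE => /orP[] /eqP ->.
  by exists y; rewrite // eq_sym.
by exists x; rewrite // setUC.
Qed.

Lemma star_graph_wf (T : finType) (v : T) (Y : {set T}) :
  wf_graph (v |: Y, [set [set v; y] | y in Y :\ v]).
Proof.
apply/forall_inP => _ /imsetP[y /setD1P[ne_yv yY] ->] /=.
by rewrite cards2 (eq_sym v) ne_yv subUset !sub1set setU11 setU1r.
Qed.

(** The centre is removed from the set of leaves in the edge set, so that a
graph results for every Y; it is a star when v is not in Y. *)
Definition star_graph (T : finType) (v : T) (Y : {set T}) : graph T :=
  Graph (star_graph_wf v Y).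

Lemma star_graph_is_star (T : finType) (v : T) (Y : {set T}) :
  v \notin Y -> is_star #|Y| (star_graph v Y).
Proof.
move=> vY; exists [set v], Y; split; rewrite ?cards1 ?disjoints1 //.
rewrite /gedges /=; apply/setP => e; apply/imsetP/imset2P.
  by case=> y /setD1P[_ yY] ->; exists v y; rewrite ?set11.
case=> x y /set1P-> yY ->; exists y => //; rewrite !inE yY andbT.
by apply: contraNneq vY => <-.
Qed.

Lemma card_star_edges (T : finType) (k : nat) (S : graph T) :
  is_star k S -> #|gedges S| = k.
Proof.
case=> X [Y [dXY /eqP/cards1P[v ->] <- _ ->]].
suff -> : [set [set x; y] | x in [set v], y in Y] = [set [set v; y] | y in Y].
  by rewrite card_imset //; apply: set2_inj.
apply/setP => e; apply/imset2P/imsetP => [[x y /set1P-> yY ->]|[y yY ->]].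
  by exists y.
by exists v y; rewrite ?set11.
Qed.

(** The slots are triples (v, i, j) with i < c v and j < k, and an edge may
occupy the slots at its two ends. The edges inside X only fit into slots at
vertices of X, so the bound on them is Hall's condition. As there are exactly as
many slots as edges, every slot is occupied, and the k edges in the slots
(v, i, _) form the i-th star centred at v. *)
Lemma star_decomposition_of_centres (T : finType) (k : nat)
    (E : {set {set T}}) (c : T -> nat) :
    0 < k -> {in E, forall e : {set T}, #|e| = 2} -> #|E| = k * \sum_v c v ->
    (forall X : {set T}, #|edges_within E X| <= k * \sum_(v in X) c v) ->
  exists B : {set graph T},
    (forall S, S \in B -> is_star k S /\ gedges S \subset E) /\
    {in E, forall e, #|[set S in B | e \in gedges S]| = 1}.
Proof.
move=> k_gt0 E2 cardE boundE.
have [->|[e0 e0E]] := set_0Vmem E.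
  by exists set0; split=> [S|e]; rewrite inE.
have [v0 _] : exists v, v \in e0.
  by apply/card_gt0P; rewrite E2.
have [N c_lt] : exists N, forall v, c v < N.+1.
  by exists (\sum_v c v) => v; rewrite ltnS (bigD1 v) //= leq_addr.
pose slots (e : {set T}) : {set T * 'I_N.+1 * 'I_k} :=
  [set p : T * 'I_N.+1 * 'I_k | (p.1.1 \in e) && (p.1.2 < c p.1.1)].
have card_slots (X : {set T}) : #|slots X| = k * \sum_(v in X) c v.
  have -> : slots X = setX [set q : T * 'I_N.+1 | (q.1 \in X) && (q.2 < c q.1)] setT.
    by apply/setP => p; rewrite !inE andbT.
  rewrite cardsX cardsT card_ord mulnC; congr (_ * _).
  rewrite -sum1dep_card.
  rewrite -(pair_big_dep (mem X) (fun v (i : 'I_N.+1) => i < c v) (fun _ _ => 1)) /=.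
  apply: eq_bigr => v _.
  by rewrite -(big_ord_widen _ (fun=> 1)) ?sum1_card ?card_ord // ltnW.
have [|f [f_inj fN]] := @hall_marriage _ _ (v0, ord0, Ordinal k_gt0) E slots.
  move=> F FE; apply: leq_trans (subset_leq_card _) (leq_trans (boundE (cover F)) _).
    by apply/subsetP => e eF; rewrite inE (subsetP FE) //= bigcup_sup.
  rewrite -card_slots; apply/subset_leq_card/subsetP => p.
  rewrite inE => /andP[/bigcupP[e eF pe] p_lt].
  by apply/bigcupP; exists e; rewrite // inE pe.
have f_im : f @: E = slots setT.
  apply/eqP; rewrite eqEcard card_in_imset // card_slots cardE.
  rewrite (eq_bigl xpredT) => [|v]; last by rewrite inE.
  rewrite leqnn andbT; apply/subsetP => _ /imsetP[e eE ->].
  by have := fN e eE; rewrite !inE => /andP[_ ->].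
pose leaves (p : T * 'I_N.+1) :=
  [set w | ([set p.1; w] \in E) && ((f [set p.1; w]).1 == p)].
pose star_at p := star_graph p.1 (leaves p).
have in_leaves p : p.1 \notin leaves p.
  apply/negP; rewrite inE setUid => /andP[/E2]; by rewrite cards1.
have star_edges p e : (e \in gedges (star_at p)) = (e \in E) && ((f e).1 == p).
  apply/imsetP/andP.
    by case=> w /setD1P[_]; rewrite inE => /andP[wE wp] ->.
  case=> eE ep; have := fN e eE; rewrite inE (eqP ep) => /andP[pe _].
  have [w ne_w def_e] := edge_through (E2 e eE) pe.
  by exists w; rewrite // !inE ne_w -def_e eE.
have card_leaves (p : T * 'I_N.+1) : p.2 < c p.1 -> #|leaves p| = k.
  move=> lt_p.
  rewrite -(card_star_edges (star_graph_is_star (in_leaves p))).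
  have f_inj_p : {in gedges (star_at p) &, injective f}.
    by move=> e1 e2; rewrite !star_edges => /andP[e1E _] /andP[e2E _]; apply: f_inj.
  rewrite -(card_in_imset f_inj_p).
  have -> : f @: gedges (star_at p) = setX [set p] setT.
    apply/setP => q; rewrite !inE andbT; apply/imsetP/eqP.
      by case=> e; rewrite star_edges => /andP[_ /eqP <-] ->.
    move=> def_q; have : q \in slots setT by rewrite !inE def_q.
    rewrite -f_im => /imsetP[e eE def_f].
    by exists e; rewrite // star_edges eE -def_f def_q eqxx.
  by rewrite cardsX cards1 cardsT card_ord mul1n.
exists [set star_at p | p : T * 'I_N.+1 & p.2 < c p.1]; split.
  move=> _ /imsetP[p lt_p ->]; rewrite inE in lt_p; split.
    by rewrite -(card_leaves p lt_p); apply: star_graph_is_star.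
  by apply/subsetP => e; rewrite star_edges => /andP[].
move=> e eE; apply/eqP/cards1P; exists (star_at (f e).1).
apply/setP => S; rewrite !inE; apply/andP/eqP => [[/imsetP[p _ ->]]|->].
  by rewrite star_edges => /andP[_ /eqP ->].
split; last by rewrite star_edges eE eqxx.
apply/imsetP; exists (f e).1 => //.
by have := fN e eE; rewrite !inE => /andP[_ ->].
Qed.

(** * Inequalities for the numbers of centres *)

Lemma quadratic_under_chord (p q : int) (a b j : nat) : a <= j <= b ->
    (a%:Z * (a%:Z - 1) <= p + q * a%:Z)%R ->
    (b%:Z * (b%:Z - 1) <= p + q * b%:Z)%R ->
  (j%:Z * (j%:Z - 1) <= p + q * j%:Z)%R.
Proof.
move=> /andP[le_aj le_jb] leA leB.
have [eq_ab|lt_ab] := leqP b a.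
  by have -> : j = a by lia.
rewrite -subr_ge0 in leA; rewrite -subr_ge0 in leB.
have [le_aj' le_jb' lt_ab'] : [/\ (0 <= j%:Z - a%:Z)%R, (0 <= b%:Z - j%:Z)%R
  & (0 < b%:Z - a%:Z)%R] by split; lia.
rewrite -subr_ge0 -(pmulr_rge0 _ lt_ab').
have := addr_ge0 (addr_ge0 (mulr_ge0 le_jb' leA) (mulr_ge0 le_aj' leB))
  (mulr_ge0 (ltW lt_ab') (mulr_ge0 le_aj' le_jb')).
by congr (0 <= _)%R; ring.
Qed.

Lemma mul2_bin2 m : 2 * 'C(m, 2) = m * m.-1.
Proof. by rewrite -[m.-1 in RHS]bin1 mul_bin_diag. Qed.

Lemma mul_pred_add m : m * m.-1 + m = m * m.
Proof. by case: m => // m; rewrite /= -mulnSr. Qed.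

(** Here W is a set of v old vertices that spans l' of the l edges left among
the n old ones, and X consists of W and j of the s new vertices. Each old
vertex is the centre of one star, r new vertices are centres of c0 + 1 stars and
the others of c0, so that at least c0 * j + (j - (s - r)) stars are centred at
the j new vertices of X. The inequality is Hall's condition for X, doubled.
Both sides are compared at the ends of the two ranges of j on which the
right-hand side is linear: j = 0, j = s - r and j = s. *)
Lemma balanced_centres_bound (k s n l v l' c0 r j : nat) :
    2 * (k * (n + c0 * s + r)) = 2 * l + 2 * (n * s) + s * s.-1 ->
    v <= n -> l' <= l -> 2 * l' <= v * k.-1 -> 2 * l' <= v * v.-1 ->
    0 < k -> k <= s -> r < s -> (2 * k <= s) || (0 < c0) -> j <= s ->
  2 * l' + 2 * (v * j) + j * j.-1 <= 2 * (k * (v + c0 * j + (j - (s - r)))).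
Proof.
move=> tot le_vn le_l deg_l simple_l k_gt0 le_ks lt_rs hc0 le_js.
have [d def_n] : exists d, n = v + d by exists (n - v); lia.
have [i def_s] : exists i, s = r + i by exists (s - r); lia.
have -> : s - r = i by lia.
have le_dks : k * d <= s * d by rewrite leq_mul2r le_ks orbT.
have at0 : 2 * l' <= 2 * (k * v).
  have : v * k.-1 <= v * k by rewrite leq_mul2l leq_pred orbT.
  lia.
have ats : 2 * l' + 2 * (v * s) + s * s.-1 <= 2 * (k * (v + c0 * s + r)).
  by move: tot; rewrite def_n !mulnDr !mulnDl; lia.
have ati : 2 * l' + 2 * (v * i) + i * i.-1 <= 2 * (k * (v + c0 * i)).
  have [r0|r_gt0] := posnP r.
    by move: ats; rewrite def_s r0 add0n addn0.
  have s_gt0 : 0 < s by lia.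
  (* After multiplication by s, the total number of stars can be used to
     eliminate c0; the remaining inequality carries the factor s - i = r. *)
  have scaled : 2 * l' + i * (2 * k) <= 2 * (k * v) + i * s ->
      2 * l' + 2 * (v * i) + i * i.-1 <= 2 * (k * (v + c0 * i)).
    move=> le_main; rewrite -(leq_pmul2l s_gt0).
    have le_r := leq_mul (leqnn r) le_main.
    have le_i := leq_mul (leqnn i) le_l.
    have le_d := leq_mul (leqnn i) le_dks.
    have eq_tot := congr1 (muln i) tot.
    have sq_i := congr1 (muln s) (mul_pred_add i).
    have sq_s := congr1 (muln i) (mul_pred_add s).
    move: le_r le_i le_d eq_tot sq_i sq_s; rewrite def_s def_n.
    rewrite !(mulnDl, mulnDr); lia.
  have [le_2ks|lt_s2k] := leqP (2 * k) s.
    apply: scaled; have := leq_mul (leqnn i) le_2ks; lia.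
  have c0_gt0 : 0 < c0 by lia.
  have [le_iv|lt_vi] := leqP i v.
    apply: scaled; have := leq_mul (leqnn i) le_ks.
    have := leq_mul (leqnn k) le_iv.
    have : v * k.-1 + v = v * k by case: (k) k_gt0 => // k' _; rewrite mulnS addnC.
    lia.
  (* For v < i the bound 2 * l' <= v * (v - 1) is used. If v + i <= 2k + 1 then
     even v + i pairwise adjacent vertices satisfy the condition. Otherwise
     2k + 1 - i < v < i, and x * (2k + 1 - x) is larger at v than at i. *)
  have [le_sum|lt_sum] := leqP (v + i) (2 * k).+1.
    have := leq_mul (leqnn (v + i)) le_sum.
    have := mul_pred_add i; have := mul_pred_add v.
    have := leq_mul (leqnn (k * i)) c0_gt0.
    rewrite !(mulnDl, mulnDr); lia.
  apply: scaled.
  have [e def_i] : exists e, i = v + e by exists (i - v); lia.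
  have [g def_sum] : exists g, v + i = 2 * k + g by exists (v + i - 2 * k); lia.
  have [h def_s'] : exists h, s = i.+1 + h by exists (s - i.+1); lia.
  have sq_v := mul_pred_add v.
  have := congr1 (muln e) def_sum.
  rewrite def_s' !(mulnDl, mulnDr, mulnS); lia.
have [le_ji|lt_ij] := leqP j i.
  have := @quadratic_under_chord (2 * k%:Z * v%:Z - 2 * l'%:Z)%R
    (2 * k%:Z * c0%:Z - 2 * v%:Z)%R 0 i j.
  have := mul_pred_add i; have := mul_pred_add j.
  lia.
have := @quadratic_under_chord (2 * k%:Z * v%:Z - 2 * l'%:Z - 2 * k%:Z * i%:Z)%R
   (2 * k%:Z * c0%:Z - 2 * v%:Z + 2 * k%:Z)%R i s j.
have := mul_pred_add i; have := mul_pred_add j; have := mul_pred_add s.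
have [e def_j] : exists e, j = i + e by exists (j - i); lia.
have -> : j - i = e by lia.
lia.
Qed.

(** The notation is that of [balanced_centres_bound], except that the centres
are now all new vertices and the old ones outside an independent set of z
elements; p counts the centres in W. At j = 0 the condition holds because each
edge inside W has an end that is a centre, at j = s by comparison with the total
number of edges. *)
Lemma independent_centres_bound (k s n l v l' z p j : nat) :
    2 * (k * (n - z + s)) = 2 * l + 2 * (n * s) + s * s.-1 ->
    v <= n -> l' <= l -> l' <= k * p -> n - z <= p + (n - v) ->
    k <= s -> j <= s ->
  2 * l' + 2 * (v * j) + j * j.-1 <= 2 * (k * (p + j)).
Proof.
move=> tot le_vn le_l le_kp le_p le_ks le_js.
have ats : 2 * l' + 2 * (v * s) + s * s.-1 <= 2 * (k * (p + s)).
  have [d def_n] : exists d, n = v + d by exists (n - v); lia.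
  have := leq_mul (leqnn k) le_p; have := leq_mul le_ks (leqnn d).
  have -> : n - v = d by lia.
  move: tot; rewrite def_n !(mulnDl, mulnDr); lia.
have := @quadratic_under_chord (2 * k%:Z * p%:Z - 2 * l'%:Z)%R
  (2 * k%:Z - 2 * v%:Z)%R 0 s j.
have := mul_pred_add j; have := mul_pred_add s; lia.
Qed.

(** If b + a < n + s, then the formula for b gives 2ka + 2l <= k(k - 1), where
s >= k is used in the form (s - k)(s - k - 1) >= 0. Hence the numbers 2ka and
n + 2l have a sum of at most k(k - 1) + n and a product of at least 2k n^2, which
contradicts the inequality between their means. *)
Lemma enough_independent (k s n l a b : nat) :
    k <= s -> (k * k.-1 + n) ^ 2 < 8 * k * n ^ 2 -> n ^ 2 <= a * (n + 2 * l) ->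
    2 * (k * b) = 2 * l + 2 * (n * s) + s * s.-1 ->
  n + s <= b + a.
Proof.
move=> le_ks big_n le_a tot; rewrite leqNgt; apply/negP => lt_ba.
have : 2 * (k * a) + (n + 2 * l) <= k * k.-1 + n.
  have [d def_s] : exists d, s = k + d by exists (s - k); lia.
  have := leq_mul (leqnn (2 * k)) lt_ba.
  have := mul_pred_add k; have := mul_pred_add s; have := mul_pred_add d.
  move: tot; rewrite def_s !(mulnDl, mulnDr, mulnS); lia.
have := nat_AGM2 (2 * (k * a)) (n + 2 * l).
move=> [le_agm _]; rewrite -leq_sqr => le_sq.
have := leq_trans le_agm le_sq.
have := leq_mul (leqnn (8 * k)) le_a.
lia.
Qed.

(** * Counting edges inside a vertex set *)

Lemma subset_of_card (T : finType) (A : {set T}) (m : nat) :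
  m <= #|A| -> exists2 B : {set T}, B \subset A & #|B| = m.
Proof.
case/card_geqP => s [s_uniq <- sA]; exists [set:: s].
  by apply/subsetP => x; rewrite inE => /sA.
by rewrite cardsE; apply/card_uniqP.
Qed.

Lemma card_edges_within_le (T : finType) (E : {set {set T}}) (W : {set T}) :
  {in E, forall e : {set T}, #|e| = 2} -> #|edges_within E W| <= 'C(#|W|, 2).
Proof.
move=> E2; rewrite -cards_draws; apply/subset_leq_card/subsetP => e.
by rewrite !inE => /andP[/E2-> ->].
Qed.

Lemma handshake (T : finType) (E : {set {set T}}) (W : {set T}) :
    {in E, forall e : {set T}, #|e| = 2} ->
  2 * #|edges_within E W| = \sum_(u in W) #|neighbours E u :&: W|.
Proof.
move=> E2; pose D := edges_within E W.
have deg u : u \in W ->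
    #|neighbours E u :&: W| = \sum_(e in D) (u \in e).
  move=> uW; rewrite -(card_imset _ (@set2_inj T u)) -big_mkcondr /= sum1dep_card.
  apply: eq_card => e; rewrite !inE; apply/imsetP/andP.
    case=> w; rewrite !inE => /andP[uwE wW] ->.
    by rewrite uwE set21 subUset !sub1set uW.
  case=> /andP[eE eW] ue; have [w _ def_e] := edge_through (E2 e eE) ue.
  exists w => //; rewrite !inE -def_e eE (subsetP eW) //.
  by rewrite def_e set22.
rewrite (eq_bigr _ deg) exchange_big /= mulnC -sum_nat_const.
apply: eq_bigr => e; rewrite inE => /andP[/E2 e2 eW].
rewrite -e2 -big_mkcondr /= sum1dep_card; apply: eq_card => u.
by rewrite !inE; case ue: (u \in e); rewrite ?andbF // (subsetP eW).
Qed.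

(** Each edge inside W has an end outside the independent set Z, and each vertex
accounts for at most k edges. *)
Lemma edges_within_cover_bound (T : finType) (E : {set {set T}}) (k : nat)
    (W Z : {set T}) :
    {in E, forall e : {set T}, #|e| = 2} ->
    {in W, forall u, #|neighbours E u :&: W| <= k} ->
    {in Z &, forall u w, [set u; w] \notin E} ->
  #|edges_within E W| <= k * #|W :\: Z|.
Proof.
move=> E2 deg indep.
pose F u := [set [set u; w] | w in neighbours E u :&: W].
have sub : edges_within E W \subset \bigcup_(u in W :\: Z) F u.
  apply/subsetP => e; rewrite inE => /andP[eE eW].
  have [eZ|] := boolP (e \subset Z).
    have /eqP/cards2P[x [y [_ def_e]]] := E2 e eE.
    move: eZ; rewrite def_e subUset !sub1set => /andP[xZ yZ].
    by have := indep x y xZ yZ; rewrite -def_e eE.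
  case/subsetPn => u ue uZ; have [w _ def_e] := edge_through (E2 e eE) ue.
  apply/bigcupP; exists u; first by rewrite inE uZ (subsetP eW).
  apply/imsetP; exists w => //; rewrite !inE -def_e eE (subsetP eW) //.
  by rewrite def_e set22.
apply: leq_trans (subset_leq_card sub) _.
apply: (@leq_trans (\sum_(u in W :\: Z) #|F u|)).
  apply: (big_ind2 (fun (B : {set {set T}}) m => #|B| <= m)) => //.
    by rewrite cards0.
  by move=> B1 m1 B2 m2 le1 le2; rewrite cardsU; lia.
rewrite mulnC -sum_nat_const; apply: leq_sum => u; rewrite inE => /andP[_ uW].
by rewrite card_imset ?deg //; apply: set2_inj.
Qed.

(** * Maximal packings of stars inside a vertex set *)

Lemma complete_on_wf (T : finType) (V : {set T}) :
  wf_graph (V, [set e : {set T} | e \subset V & #|e| == 2]).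
Proof. by apply/forall_inP => e; rewrite inE /= => /andP[-> ->]. Qed.

(** The complete graph on the old vertices, as a graph on all vertices: the
stars found inside it have the same type as those of the final decomposition. *)
Definition complete_on (T : finType) (V : {set T}) : graph T :=
  Graph (complete_on_wf V).

Definition uncovered (T : finType) (A : {set graph T}) : {set {set T}} :=
  gedges (complete_graph T) :\: covered A.

Lemma uncovered_card2 (T : finType) (A : {set graph T}) :
  {in uncovered A, forall e : {set T}, #|e| = 2}.
Proof. by move=> e; rewrite inE => /andP[_]; rewrite inE => /eqP. Qed.

Lemma graph_edge_card (T : finType) (G : graph T) (e : {set T}) :
  e \in gedges G -> #|e| = 2.
Proof. by have /forall_inP wf := graph_wf G => /wf /andP[/eqP]. Qed.

Lemma graph_edge_sub (T : finType) (G : graph T) (e : {set T}) :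
  e \in gedges G -> e \subset gverts G.
Proof. by have /forall_inP wf := graph_wf G => /wf /andP[]. Qed.

Lemma subgraph_complete_on (T : finType) (G : graph T) (V : {set T}) :
  subgraph G (complete_on V) = (gverts G \subset V).
Proof.
rewrite /subgraph /=; case: (boolP (_ \subset V)) => //= GV.
apply/subsetP => e eG; rewrite inE (graph_edge_card eG) andbT.
exact: subset_trans (graph_edge_sub eG) GV.
Qed.

Lemma covered_within (T : finType) (k : nat) (V : {set T}) (A : {set graph T})
    (e : {set T}) :
  partial_star_decomposition k (complete_on V) A -> e \in covered A ->
  e \subset V.
Proof.
case=> starA _ /bigcupP[S SA eS]; have [_] := starA S SA.
by rewrite subgraph_complete_on; apply: subset_trans; apply: graph_edge_sub.
Qed.

Lemma card_covered (T : finType) (k : nat) (G : graph T) (A : {set graph T}) :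
  partial_star_decomposition k G A -> #|covered A| = k * #|A|.
Proof.
case=> starA atmost1; rewrite mulnC -sum_nat_const.
have edgesA S : S \in A -> k = \sum_(e in covered A) (e \in gedges S).
  move=> SA; have [starS _] := starA S SA.
  rewrite -(card_star_edges starS) -big_mkcondr /= sum1dep_card.
  apply: eq_card => e; rewrite !inE; case eS: (e \in gedges S); rewrite ?andbF //.
  by rewrite andbT; symmetry; apply/bigcupP; exists S.
rewrite (eq_bigr _ edgesA) exchange_big /= -sum1_card.
apply: eq_bigr => e /bigcupP[S SA eS]; rewrite -big_mkcondr /= sum1dep_card.
have [_ /andP[_ /subsetP SG]] := starA S SA.
apply/eqP; rewrite eq_sym eqn_leq atmost1 ?SG //=.
by apply/card_gt0P; exists S; rewrite inE SA.
Qed.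

(** A vertex with k uncovered edges inside V would be the centre of a further
star. *)
Lemma extend_to_maximal (T : finType) (k : nat) (V : {set T})
    (A : {set graph T}) :
    0 < k -> partial_star_decomposition k (complete_on V) A ->
  exists2 A' : {set graph T}, A \subset A'
    & partial_star_decomposition k (complete_on V) A' /\
    {in V, forall v, #|neighbours (uncovered A') v :&: V| < k}.
Proof.
move=> k_gt0; have [m] := ubnP #|uncovered A|; elim: m A => // m IHm A le_m packA.
have [/forall_inP deg_lt|] :=
    boolP [forall v in V, #|neighbours (uncovered A) v :&: V| < k].
  by exists A.
case/forall_inPn => v vV; rewrite -leqNgt => /subset_of_card[Y YN cardY].
have vY : v \notin Y.
  apply/negP => /(subsetP YN); rewrite !inE => /andP[/andP[_]].
  by rewrite setUid cards1.
pose S := star_graph v Y.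
have starS : is_star k S by rewrite -cardY; apply: star_graph_is_star.
have S_unc e : e \in gedges S -> e \in uncovered A.
  case/imsetP => y /setD1P[_ /(subsetP YN)] /setIP[+ _] ->.
  by rewrite inE.
have S_new S' e : S' \in A -> e \in gedges S -> e \notin gedges S'.
  move=> S'A /S_unc; rewrite inE => /andP[+ _]; apply: contra => eS'.
  by apply/bigcupP; exists S'.
have SV : gverts S \subset V.
  by rewrite subUset sub1set vV (subset_trans YN) ?subsetIr.
have [||A' sub packA'] := IHm (S |: A).
- rewrite -ltnS; apply: leq_trans le_m; rewrite ltnS; apply/proper_card.
  have /card_gt0P[e eS] : 0 < #|gedges S| by rewrite (card_star_edges starS).
  apply/properP; split.
    by apply/setDS/subsetP => e' /bigcupP[S' S'A e'S'];
      apply/bigcupP; exists S'; rewrite // setU1r.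
  exists e; first exact: S_unc.
  by rewrite inE negb_and negbK; apply/orP; left; apply/bigcupP; exists S;
    rewrite ?setU11.
- have [starA atmost1] := packA; split=> [S' /setU1P[->|/starA //]|e eG].
    by rewrite subgraph_complete_on.
  have [eS|eS] := boolP (e \in gedges S).
    rewrite -(cards1 S); apply/subset_leq_card/subsetP => S'.
    rewrite !inE => /andP[/orP[//|S'A] eS'].
    by have := S_new S' e S'A eS; rewrite eS'.
  apply: leq_trans (atmost1 e eG); apply/subset_leq_card/subsetP => S'.
  by rewrite !inE => /andP[/orP[/eqP->|->] eS'] //; rewrite eS' in eS.
by exists A'; first exact: subset_trans (subsetUr _ _) sub.
Qed.

(** All stars lie inside V, so every pair that is not contained in V is
uncovered. *)
Lemma card_uncovered_within (T : finType) (k : nat) (V : {set T})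
    (A : {set graph T}) (X : {set T}) :
    partial_star_decomposition k (complete_on V) A ->
  #|edges_within (uncovered A) X| =
    #|edges_within (uncovered A) (X :&: V)| + #|X :&: V| * #|X :\: V|
      + 'C(#|X :\: V|, 2).
Proof.
move=> packA.
have pairs (Y : {set T}) : 'C(#|Y|, 2) =
    #|edges_within (uncovered A) Y| + #|edges_within (covered A) Y|.
  rewrite -cards_draws -[LHS](cardsID (covered A)) addnC; congr (_ + _).
    by apply: eq_card => e; rewrite !inE; case: (_ \subset Y); rewrite ?andbT ?andbF.
  apply: eq_card => e; rewrite !inE andbC.
  case eA: (e \in covered A) => //=; have /bigcupP[S _ eS] := eA.
  by rewrite (graph_edge_card eS) andbT.
have eq_cov : edges_within (covered A) X = edges_within (covered A) (X :&: V).
  apply/setP => e; rewrite !inE subsetI.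
  by case eA: (e \in covered A) => //=; rewrite (covered_within packA eA) andbT.
have := pairs X; have := pairs (X :&: V); rewrite eq_cov.
have := mul2_bin2 #|X|; have := mul2_bin2 #|X :&: V|; have := mul2_bin2 #|X :\: V|.
have := mul_pred_add #|X|; have := mul_pred_add #|X :&: V|.
have := mul_pred_add #|X :\: V|.
rewrite -(cardsID V X) !mulnDl !mulnDr; lia.
Qed.

(** * Completion of a packing *)

Lemma sum_mem (T : finType) (X Y : {set T}) :
  \sum_(v in X) (v \in Y : nat) = #|X :&: Y|.
Proof.
by rewrite -big_mkcondr /= sum1dep_card; apply: eq_card => v; rewrite !inE.
Qed.

(** The number of stars centred at a vertex is 1 on V :\: Z, 0 on Z, c0 + 1 on R
and c0 on the other new vertices. The bound only involves a lower estimate of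
the number of elements of R among j new vertices. *)
Lemma completion_from_centres (T : finType) (k c0 : nat) (V Z R : {set T})
    (A : {set graph T}) :
    0 < k -> partial_star_decomposition k (complete_on V) A -> R \subset ~: V ->
    #|uncovered A| = k * (#|V :\: Z| + c0 * #|~: V| + #|R|) ->
    (forall (W : {set T}) (j : nat), W \subset V -> j <= #|~: V| ->
      2 * #|edges_within (uncovered A) W| + 2 * (#|W| * j) + j * j.-1 <=
        2 * (k * (#|W :\: Z| + c0 * j + (j - (#|~: V| - #|R|))))) ->
  exists2 B : {set graph T}, A \subset B
    & star_decomposition k (complete_graph T) B.
Proof.
move=> k_gt0 packA RV total bound.
pose c v : nat := (v \in V :\: Z) + c0 * (v \in ~: V) + (v \in R).
have sum_c (X : {set T}) :
    \sum_(v in X) c v = #|X :&: V :\: Z| + c0 * #|X :\: V| + #|X :&: R|.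
  by rewrite !big_split -big_distrr /= !sum_mem setIDA [X :\: V]setDE.
have [||X|B [starB decB]] := @star_decomposition_of_centres T k (uncovered A) c k_gt0.
- exact: uncovered_card2.
- rewrite total; congr (_ * _); transitivity (\sum_(v in setT) c v).
    by rewrite sum_c !setTI setTD.
  by apply: eq_bigl => v; rewrite inE.
- rewrite sum_c (card_uncovered_within _ packA).
  have le_j : #|X :\: V| <= #|~: V|.
    by apply/subset_leq_card; rewrite setDE subsetIr.
  have le_R : #|X :\: V| <= #|X :&: R| + (#|~: V| - #|R|).
    rewrite -(cardsID R (X :\: V)); apply: leq_add.
      by apply/subset_leq_card/setSI/subsetDl.
    have -> : #|~: V| - #|R| = #|~: V :\: R| by rewrite cardsD (setIidPr RV).
    by apply/subset_leq_card/setSD; rewrite setDE subsetIr.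
  have := bound (X :&: V) _ (subsetIr _ _) le_j.
  rewrite -mul2_bin2 -!mulnDr leq_mul2l /=; move/leq_trans; apply.
  by rewrite leq_mul2l leq_add2l leq_subLR addnC le_R orbT.
have [starA atmost1] := packA.
exists (A :|: B); first exact: subsetUl.
split=> [S|e eG].
  have sub_complete S' : subgraph S' (complete_graph T).
    rewrite /subgraph subsetT; apply/subsetP => e eS'.
    by rewrite inE (graph_edge_card eS').
  by case/setUP => [/starA|/starB] [].
have [eA|eA] := boolP (e \in covered A).
  have eV := covered_within packA eA; have /bigcupP[S SA eS] := eA.
  apply/eqP; rewrite eqn_leq; apply/andP; split; last first.
    by apply/card_gt0P; exists S; rewrite !inE SA eS.
  apply: leq_trans (atmost1 e _); last by rewrite inE eV (graph_edge_card eG).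
  apply/subset_leq_card/subsetP => S'; rewrite !inE.
  case/andP => /orP[->|/starB[_ /subsetP sub] eS'] // .
  by have := sub e eS'; rewrite inE eA.
have eE : e \in uncovered A by rewrite inE eA.
rewrite -[RHS](decB e eE); apply: eq_card => S; rewrite !inE.
case SA: (S \in A) => //=; case eS: (e \in gedges S); rewrite ?andbF //.
by case/bigcupP: eA; exists S.
Qed.

(** If there are fewer than n + s stars to be found and s < 2k, then one star at
each old vertex would leave some new vertices without a star. An edge
between two of those would have no possible centre, which is why an independent
set of old vertices gives up its stars instead. *)
Lemma star_completion (T : finType) (k : nat) (V : {set T})
    (A : {set graph T}) :
    0 < k -> k %| 'C(#|T|, 2) -> k <= #|~: V| ->
    (2 * k <= #|~: V|) || ((k * k.-1 + #|V|) ^ 2 < 8 * k * #|V| ^ 2) ->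
    partial_star_decomposition k (complete_on V) A ->
  exists2 B : {set graph T}, A \subset B
    & star_decomposition k (complete_graph T) B.
Proof.
move=> k_gt0 dvd_k le_ks large packA0.
have [A' sub [packA deg]] := extend_to_maximal k_gt0 packA0.
suff [B sub' decB] : exists2 B : {set graph T}, A' \subset B
    & star_decomposition k (complete_graph T) B.
  by exists B => //; apply: subset_trans sub'.
move: {A sub packA0} A' packA deg => A packA deg.
set E := uncovered A in deg *; have E2 : {in E, forall e : {set T}, #|e| = 2}.
  exact: uncovered_card2.
pose s := #|~: V|; pose n := #|V|; pose l := #|edges_within E V|.
have cardE : 2 * #|E| = 2 * l + 2 * (n * s) + s * s.-1.
  have := card_uncovered_within setT packA.
  rewrite setTI setTD -/E -/l -/n -/s.
  have -> : edges_within E setT = E by apply/setP => e; rewrite inE subsetT andbT.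
  by move=> ->; rewrite !mulnDr mul2_bin2.
have [b def_b] : exists b, #|E| = k * b.
  have : k %| #|E| + #|covered A|.
    have <- : 'C(#|T|, 2) = #|E| + #|covered A|; last by [].
    rewrite -cardsT -cards_draws -[LHS](cardsID (covered A)) addnC.
    congr (_ + _); apply: eq_card => e; rewrite !inE ?subsetT //.
    case eA: (e \in covered A); rewrite ?andbF //=.
    by have /bigcupP[S _ /graph_edge_card ->] := eA.
  rewrite (card_covered packA) dvdn_addl ?dvdn_mulr // => /dvdnP[b ->].
  by exists b; rewrite mulnC.
have deg_within (W : {set T}) : W \subset V ->
    {in W, forall u, #|neighbours E u :&: W| <= k.-1}.
  move=> WV u uW; rewrite -ltnS prednK //; apply: leq_trans (deg u (subsetP WV u uW)).
  by rewrite ltnS; apply/subset_leq_card/setIS.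
have le_l (W : {set T}) : W \subset V -> #|edges_within E W| <= l.
  move=> WV; apply/subset_leq_card/subsetP => e; rewrite !inE => /andP[-> eW] /=.
  exact: subset_trans WV.
have [ge_b|lt_b] := boolP ((2 * k <= s) || (n + s <= b)).
  have le_nb : n <= b.
    case/orP: ge_b => [le_2ks|]; last by lia.
    rewrite -(leq_pmul2l k_gt0) -def_b.
    have := leq_mul le_2ks (leqnn n).
    have : k * n <= n * s by rewrite mulnC leq_mul2l le_ks orbT.
    lia.
  have s_gt0 : 0 < s by lia.
  have [R RV cardR] : exists2 R : {set T}, R \subset ~: V
      & #|R| = (b - n) %% s by apply/subset_of_card/ltnW/ltn_pmod.
  have def_bn : b = n + (b - n) %/ s * s + #|R|.
    by rewrite cardR; have := divn_eq (b - n) s; lia.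
  apply: (@completion_from_centres T k ((b - n) %/ s) V set0 R A) => //.
    by rewrite setD0 -/E def_b -/s -/n -def_bn.
  move=> W j WV le_j; rewrite setD0; apply: (@balanced_centres_bound k s n l) => //.
  - by rewrite -def_bn -def_b.
  - exact: subset_leq_card.
  - exact: le_l.
  - rewrite handshake // -sum_nat_const; apply: leq_sum; exact: deg_within.
  - by rewrite -mul2_bin2 leq_mul2l card_edges_within_le.
  - by rewrite cardR ltn_pmod.
  - case/orP: ge_b => [-> //|le_nsb]; apply/orP; right.
    by rewrite divn_gt0 //; lia.
case/norP: lt_b; rewrite -!ltnNge => lt_s2k lt_b.
move: large; rewrite leqNgt lt_s2k /= => large.
(* [independent_set_bound] is about closed neighbourhoods, hence the u == w. *)
pose adj u w := (u == w) || ([set u; w] \in E).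
have [||Z0 [Z0V indepZ0 le_Z0]] := @independent_set_bound T adj V.
- by move=> u; rewrite /adj eqxx.
- by move=> u w; rewrite /adj eq_sym setUC.
have sum_adj : \sum_(u in V) #|[set w in V | adj u w]| = n + 2 * l.
  rewrite handshake // -[n]sum1_card -big_split /=; apply: eq_bigr => u uV.
  have -> : [set w in V | adj u w] = u |: (neighbours E u :&: V).
    apply/setP => w; rewrite in_setU1 in_setI in_set in_neighbours /adj eq_sym.
    by case: eqVneq => [->|_]; rewrite ?uV // andbC.
  have uE : u \notin neighbours E u :&: V.
    by apply/negP => /setIP[]; rewrite inE => /E2; rewrite setUid cards1.
  by rewrite cardsU1 uE.
rewrite sum_adj in le_Z0.
have le_nsb : n + s <= b + #|Z0|.
  apply: (@enough_independent k s n l) => //.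
  by rewrite -def_b.
have [Z ZZ0 cardZ] : exists2 Z : {set T}, Z \subset Z0 & #|Z| = n + s - b.
  by apply: subset_of_card; lia.
have ZV := subset_trans ZZ0 Z0V.
have le_Zn : #|Z| <= n := subset_leq_card ZV.
have cardVZ : #|V :\: Z| = n - #|Z| by rewrite cardsD (setIidPr ZV).
apply: (@completion_from_centres T k 1 V Z set0 A); rewrite ?sub0set //.
  rewrite cards0 addn0 mul1n -/E def_b cardVZ -/s; congr (_ * _); lia.
move=> W j WV le_j; rewrite cards0 subn0 (eqP le_j) addn0 mul1n.
apply: (@independent_centres_bound k s n l _ _ #|Z|) => //.
- rewrite -cardE def_b; congr (_ * (_ * _)); lia.
- exact: subset_leq_card.
- exact: le_l.
- apply: edges_within_cover_bound => //.
    by move=> u uW; apply: leq_trans (deg_within W WV u uW) (leq_pred k).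
  move=> u w uZ wZ; apply/negP => uwE.
  have eq_uw : u = w.
    by apply: indepZ0; rewrite ?(subsetP ZZ0) // /adj uwE orbT.
  by have := E2 _ uwE; rewrite eq_uw setUid cards1.
- rewrite -cardVZ -(cardsID W (V :\: Z)); apply: leq_add.
    by apply/subset_leq_card/subsetP => u; rewrite !inE => /andP[/andP[-> _] ->].
  have -> : n - #|W| = #|V :\: W| by rewrite cardsD (setIidPr WV).
  by apply/subset_leq_card/setSD/subsetDl.
Qed.

(** * The number of new vertices *)

(** It suffices that n + s is 0 or 1 modulo K, where K = k for odd k and K = 2k
for even k. The K - 1 consecutive values of s from k to k + K - 2 miss only one
residue, so one of them will do. *)
Lemma exists_admissible_order (k n : nat) : 1 < k ->
  exists s, [/\ k <= s, s <= (if odd k then 2 * k - 2 else 3 * k - 2)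
    & k %| 'C(n + s, 2)].
Proof.
move=> k_gt1; pose K := if odd k then k else 2 * k.
have K_gt1 : 1 < K by rewrite /K; case: ifP; lia.
have bound_K : (if odd k then 2 * k - 2 else 3 * k - 2) = k + K - 2.
  by rewrite /K; case: ifP; lia.
have dvd_bin m : K %| m * m.-1 -> k %| 'C(m, 2).
  rewrite -mul2_bin2 /K; case: ifP => [odd_k|_].
    by rewrite Gauss_dvdr // coprimen2.
  by rewrite dvdn_pmul2l.
rewrite bound_K; set r := (n + k) %% K.
have lt_r : r < K by rewrite ltn_mod; lia.
have def_r := divn_eq (n + k) K; rewrite -/r in def_r.
have [le_r|lt_1r] := leqP r 1.
  exists k; split=> //; first by lia.
  apply: dvd_bin; case: r le_r lt_r def_r => [|[|//]] _ _ ->.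
    by rewrite addn0 dvdn_mulr // dvdn_mull.
  by rewrite addn1 dvdn_mull //= dvdn_mull.
exists (k + K - r); split; first by lia.
  by lia.
apply: dvd_bin; apply: dvdn_mulr.
have -> : n + (k + K - r) = ((n + k) %/ K).+1 * K by rewrite mulSn; lia.
exact: dvdn_mull.
Qed.

(** Clear the denominator and square n * sqrt(8k) > k(k - 1) + n, to stay within
the natural numbers from here on. *)
Lemma order_bound_nat (R : rcfType) (k n : nat) : 1 < k ->
    (k%:R * (k%:R - 1) / (Num.sqrt (8 * k%:R) - 1) < n%:R :> R)%R ->
  (k * k.-1 + n) ^ 2 < 8 * k * n ^ 2.
Proof.
move=> k_gt1; set q := Num.sqrt _.
have sq_q : (q ^+ 2 = 8 * k%:R)%R by rewrite sqr_sqrtr // mulr_ge0.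
have q_gt1 : (1 < q)%R.
  rewrite -[X in (X < _)%R]sqrtr1 ltr_sqrt ?mulr_gt0 ?ltr0n //; last by lia.
  by rewrite -natrM ltr1n; lia.
have k1 : (k%:R - 1 = k.-1%:R :> R)%R by rewrite -subn1 natrB //; lia.
rewrite ltr_pdivrMr ?subr_gt0 // k1 mulrBr mulr1 ltrBrDr => lt_q.
rewrite -(ltr_nat R) !(natrX, natrM, natrD) -sq_q -exprMn.
have q_ge0 : (0 <= q)%R := ltW (lt_trans ltr01 q_gt1).
by rewrite [X in (_ < X ^+ 2)%R]mulrC ltr_pXn2r ?nnegrE ?addr_ge0 ?mulr_ge0.
Qed.

(** * Stars along an injection of the vertices *)

Lemma map_graph_inj (T U : finType) (f : T -> U) (f_inj : injective f) :
  injective (map_graph f_inj).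
Proof.
move=> G H eq_GH; apply: val_inj => /=.
have := congr1 val eq_GH; rewrite /= /gverts /gedges.
case: (graph_val G) (graph_val H) => [VG EG] [VH EH] /= [eqV eqE].
by rewrite (imset_inj f_inj eqV) (imset_inj (imset_inj f_inj) eqE).
Qed.

Lemma map_star (T U : finType) (f : T -> U) (f_inj : injective f)
    (k : nat) (S : graph T) :
  is_star k S -> is_star k (map_graph f_inj S).
Proof.
case=> X [Y [dXY cX cY vS eS]]; exists (f @: X), (f @: Y); split.
- by rewrite -setI_eq0 -imsetI ?(disjoint_setI0 dXY) ?imset0 // => ? ? _ _; apply: f_inj.
- by rewrite card_imset.
- by rewrite card_imset.
- by rewrite /gverts /= vS imsetU.
rewrite /gedges /= [gedges _ in LHS]eS; apply/setP => e; apply/imsetP/imset2P.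
  case=> _ /imset2P[x y xX yY ->] ->; exists (f x) (f y); rewrite ?imset_f //.
  by rewrite imsetU1 imset_set1.
case=> _ _ /imsetP[x xX ->] /imsetP[y yY ->] ->; exists [set x; y].
  by apply/imset2P; exists x y.
by rewrite imsetU1 imset_set1.
Qed.

Lemma map_packing (T U : finType) (f : T -> U) (f_inj : injective f)
    (k : nat) (A : {set graph T}) :
    partial_star_decomposition k (complete_graph T) A ->
  partial_star_decomposition k (complete_on (f @: [set: T]))
    [set map_graph f_inj S | S in A].
Proof.
case=> starA atmost1; split=> [_ /imsetP[S SA ->]|e].
  have [starS _] := starA S SA; split; first exact: map_star.
  by rewrite subgraph_complete_on imsetS // subsetT.
rewrite inE => /andP[/subsetP eV e2].
pose e' := f @^-1: e.
have def_e : e = f @: e'.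
  apply/setP => u; apply/idP/imsetP => [ue|[x + ->]]; last by rewrite inE.
  by have /imsetP[x _ def_u] := eV u ue; exists x; rewrite // inE -def_u.
have e'G : e' \in gedges (complete_graph T).
  by rewrite inE -(card_imset _ f_inj) -def_e.
apply: leq_trans (atmost1 e' e'G); rewrite -(card_imset _ (@map_graph_inj _ _ _ f_inj)).
apply/subset_leq_card/subsetP => _ /setIdP[/imsetP[S SA ->] /imsetP[d dS eq_e]].
apply: imset_f; rewrite inE SA /=.
by rewrite def_e in eq_e; rewrite (imset_inj f_inj eq_e).
Qed.

(** * Embedding in a complete graph *)

Local Open Scope ring_scope.

Theorem theorem2 (R : rcfType) (k n : nat) (hk : (2 <= k)%N)
    (hn : k%:R * (k%:R - 1) / (Num.sqrt (8 * k%:R) - 1) < n%:R :> R)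
    (A : {set graph 'I_n}) (hA : partial_star_decomposition k (K n) A) :
  exists (s : nat) (B : {set graph 'I_(n + s)}),
    [/\ star_decomposition k (K (n + s)) B,
        embedding k (@lshift_inj n s) (K n) A (K (n + s)) B
      & (s <= if odd k then 2 * k - 2 else 3 * k - 2)%N].
Proof.
have [s [le_ks le_s dvd_k]] := exists_admissible_order n hk.
have packV := map_packing (@lshift_inj n s) hA.
set V := _ @: _ in packV.
have cardV : #|V| = n by rewrite card_imset ?cardsT ?card_ord //; apply: lshift_inj.
have cardCV : #|~: V| = s by have := cardsC V; rewrite cardV card_ord; lia.
have [||||B sub decB] := star_completion _ _ _ _ packV; rewrite ?cardCV ?card_ord //.
- by lia.
- by rewrite cardV (order_bound_nat hk hn) orbT.
exists s, B; split=> //; split=> //.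
  by have [starB cov] := decB; split=> // e /cov ->.
rewrite /subgraph subsetT; apply/subsetP => e eG.
by rewrite inE (graph_edge_card eG).
Qed.
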